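(* Let $T>0$, $Q>0$, and let $\theta,\eta:[0,T]\to(0,\infty)$ be continuously differentiable. If an extremal point of $\mathcal{J}$ is a local maximum of $\mathcal{J}$ on $\Xi(Q)$, then necessarily $$\int_0^T\phi(t)\dot\phi(t)\theta_t\,dt\;\le\;\int_0^T[\dot\phi(t)]^2\eta_t\,dt,\qquad\forall\phi\in\mathcal{C}^\infty_c((0,T)).$$
   Context: $\Xi(Q)=\{\zeta\in\mathcal{C}^2([0,T]):\ \zeta_0=Q,\ \zeta_T=0\}$ and $$\mathcal{J}(\zeta)=\int_0^T\left(\theta_t\,\dot\zeta_t\,\zeta_t-\eta_t\,\dot\zeta_t^2\right)dt .$$ An extremal point of $\mathcal{J}$ is a function $\zeta\in\Xi(Q)$ solving $2\eta_t\ddot\zeta_t+2\dot\eta_t\dot\zeta_t-\dot\theta_t\zeta_t=0$ with $\zeta_0=Q$, $\zeta_T=0$. Local maximum is understood with respect to the $\mathcal{C}^2([0,T])$ norm on $\Xi(Q)$. $\mathcal{C}^\infty_c((0,T))$ is the space of smooth functions with compact support in $(0,T)$. *)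

(* Defs.v *)
From Stdlib Require Import Reals.
From Coquelicot Require Import Coquelicot.
Open Scope R_scope.

(* Functions on [0,T] are represented by total functions R -> R whose values
   outside [0,T] are junk: no definition below looks at them. *)

Definition Icc (a b : R) : R -> Prop := fun t => a <= t <= b.

(* [is_derive] with the neighbourhoods of x replaced by their traces on D: for
   D = [a,b] with a < b this is the usual derivative inside and the one-sided
   derivative at the endpoints. *)
Definition is_derive_on (D : R -> Prop) (f : R -> R) (x l : R) : Prop :=
  filterdiff f (within D (locally x)) (fun y => scal y l).

Definition ex_derive_on (D : R -> Prop) (f : R -> R) (x : R) : Prop :=
  exists l, is_derive_on D f x l.

(* Meaningful where [ex_derive_on D f x] holds and x is a limit point of D. *)
Definition Derive_on (D : R -> Prop) (f : R -> R) (x : R) : R :=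
  iota (is_derive_on D f x).

Fixpoint Ck_on (D : R -> Prop) (k : nat) (f : R -> R) : Prop :=
  match k with
  | O => continuous_on D f
  | S k => (forall x, D x -> ex_derive_on D f x) /\ Ck_on D k (Derive_on D f)
  end.

(* [Lub_Rbar] lives in Rbar; the cast to R yields junk only if f is unbounded
   on D, which does not happen for the continuous functions on [0,T] to which
   this is applied. *)
Definition sup_norm (D : R -> Prop) (f : R -> R) : R :=
  real (Lub_Rbar (fun y => exists t, D t /\ y = Rabs (f t))).

Definition C2_norm (D : R -> Prop) (f : R -> R) : R :=
  sup_norm D f + sup_norm D (Derive_on D f)
  + sup_norm D (Derive_on D (Derive_on D f)).

Definition Xi (T Q : R) (zeta : R -> R) : Prop :=
  Ck_on (Icc 0 T) 2 zeta /\ zeta 0 = Q /\ zeta T = 0.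

Definition J (T : R) (theta eta zeta : R -> R) : R :=
  let dzeta := Derive_on (Icc 0 T) zeta in
  RInt (fun t => theta t * dzeta t * zeta t - eta t * (dzeta t) ^ 2) 0 T.

Definition extremal_point (T Q : R) (theta eta zeta : R -> R) : Prop :=
  let D := Derive_on (Icc 0 T) in
  Xi T Q zeta /\
  forall t, Icc 0 T t ->
    2 * eta t * D (D zeta) t + 2 * D eta t * D zeta t - D theta t * zeta t = 0.

Definition local_maximum (T Q : R) (theta eta zeta : R -> R) : Prop :=
  Xi T Q zeta /\
  exists delta, 0 < delta /\
    forall xi, Xi T Q xi ->
      C2_norm (Icc 0 T) (fun t => xi t - zeta t) < delta ->
      J T theta eta xi <= J T theta eta zeta.

(* Elements of C^oo_c((a,b)), identified with their extension by zero to R. *)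
Definition test_function (a b : R) (phi : R -> R) : Prop :=
  let support := adherence (fun t => phi t <> 0) in
  (forall n t, ex_derive_n phi n t) /\
  compact support /\ included support (fun t => a < t < b).

(* Main.v *)
Require Import Defs.
From Stdlib Require Import Reals.
From Stdlib Require Import Lra.
From Coquelicot Require Import Coquelicot.
Open Scope R_scope.

(* The functional is quadratic, so the second difference of [J] at [zeta] along
   [e * phi] is exactly [2 e^2] times the integral of
   [theta phi phi' - eta phi'^2].  At a local maximum this second difference is
   nonpositive for small [e]; the first variation cancels between [e] and [-e],
   so the Euler-Lagrange equation plays no role. *)

(** * Calculus of derivatives relative to a compact interval *)

(** [filterdiff] asks for the estimate at every limit of the trace filter. As x lies in [a,b], every
    ball around such a limit contains x, so x is the only one and a plain epsilon-delta condition
    remains. *)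
Lemma is_derive_on_spec (a b : R) (f : R -> R) (x l : R) :
  Icc a b x ->
  is_derive_on (Icc a b) f x l <->
  forall eps, 0 < eps -> exists d, 0 < d /\ forall y, Icc a b y ->
    Rabs (y - x) < d -> Rabs (f y - f x - (y - x) * l) <= eps * Rabs (y - x).
Proof.
intros Hx; split.
- intros [_ H] eps Heps.
  destruct (H x (fun P HP => filter_le_within (F := locally x) _ P HP)
              (mkposreal eps Heps)) as [d Hd].
  exists d; split; [apply cond_pos|]; intros y Hy Hyx.
  exact (Hd y Hyx Hy).
- intros H; split; [exact (is_linear_scal_l (K := R_AbsRing) (V := R_NormedModule) l)|].
  intros z Hz.
  assert (Hzx : z = x).
  { apply eq_close; intros eps.
    destruct (Hz _ (locally_ball z eps)) as [d Hd].
    exact (Hd x (ball_center x d) Hx). }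
  subst z; intros eps.
  destruct (H eps (cond_pos eps)) as [d [Hd Hd']].
  exists (mkposreal d Hd); intros y Hyx Hy.
  exact (Hd' y Hy Hyx).
Qed.

(** Subtracting the two estimates at a point of [a,b] other than x, with tolerance |l - m| / 4 each,
    would give |l - m| <= |l - m| / 2. *)
Lemma is_derive_on_unique (a b : R) (f : R -> R) (x l m : R) :
  a < b -> Icc a b x ->
  is_derive_on (Icc a b) f x l -> is_derive_on (Icc a b) f x m -> l = m.
Proof.
intros Hab Hx Hl Hm.
rewrite is_derive_on_spec in Hl, Hm by assumption.
apply Rminus_diag_uniq; destruct (Req_dec (l - m) 0) as [E|N]; [exact E|].
assert (Hpos : 0 < Rabs (l - m)) by now apply Rabs_pos_lt.
destruct (Hl (Rabs (l - m) / 4)) as [d1 [Hd1 H1]]; [lra|].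
destruct (Hm (Rabs (l - m) / 4)) as [d2 [Hd2 H2]]; [lra|].
set (d := Rmin (Rmin d1 d2) (b - a)).
assert (Hd : 0 < d) by (unfold d; repeat apply Rmin_glb_lt; lra).
assert (Hdd1 : d <= d1) by (unfold d; eapply Rle_trans; apply Rmin_l).
assert (Hdd2 : d <= d2)
  by (unfold d; eapply Rle_trans; [apply Rmin_l|apply Rmin_r]).
assert (Hdba : d <= b - a) by (unfold d; apply Rmin_r).
(* Since [d <= b - a], at least one of x + d/2 and x - d/2 stays in [a,b]; this also covers the
   endpoints. *)
assert (Hy : exists y, Icc a b y /\ Rabs (y - x) = d / 2).
{ destruct Hx as [Hxa Hxb]; unfold Icc.
  destruct (Rle_dec (x + d / 2) b).
  - exists (x + d / 2); split; [lra|]. rewrite Rabs_pos_eq; lra.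
  - exists (x - d / 2); split; [lra|]. rewrite Rabs_left; lra. }
destruct Hy as [y [Hy Hyx]].
specialize (H1 y Hy ltac:(lra)); specialize (H2 y Hy ltac:(lra)).
assert (Htri := Rabs_triang (f y - f x - (y - x) * m)
                            (- (f y - f x - (y - x) * l))).
rewrite Rabs_Ropp in Htri.
replace (f y - f x - (y - x) * m + - (f y - f x - (y - x) * l))
  with ((y - x) * (l - m)) in Htri by ring.
rewrite Rabs_mult, Hyx in Htri; rewrite Hyx in H1, H2.
nra.
Qed.

(** Uniqueness turns the description operator [iota] into a computation rule. *)
Lemma Derive_on_eq (a b : R) (f : R -> R) (x l : R) :
  a < b -> Icc a b x -> is_derive_on (Icc a b) f x l ->
  Derive_on (Icc a b) f x = l.
Proof.
intros Hab Hx Hl.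
apply (iota_unique (V := R_CompleteNormedModule)); [|exact Hl].
intros m Hm; exact (is_derive_on_unique a b f x m l Hab Hx Hm Hl).
Qed.

Lemma Derive_on_correct (a b : R) (f : R -> R) (x : R) :
  a < b -> Icc a b x -> ex_derive_on (Icc a b) f x ->
  is_derive_on (Icc a b) f x (Derive_on (Icc a b) f x).
Proof.
intros Hab Hx [l Hl]; now rewrite (Derive_on_eq a b f x l Hab Hx Hl).
Qed.

Lemma is_derive_on_ext (a b : R) (f g : R -> R) (x l : R) :
  Icc a b x -> (forall t, Icc a b t -> f t = g t) ->
  is_derive_on (Icc a b) f x l -> is_derive_on (Icc a b) g x l.
Proof.
intros Hx Hfg; rewrite !is_derive_on_spec by assumption.
intros H eps Heps; destruct (H eps Heps) as [d [Hd Hd']].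
exists d; split; [exact Hd|]; intros y Hy.
rewrite <- !Hfg by assumption; now apply Hd'.
Qed.

Lemma is_derive_on_of_is_derive (a b : R) (f : R -> R) (x l : R) :
  Icc a b x -> is_derive f x l -> is_derive_on (Icc a b) f x l.
Proof.
intros Hx [_ H]; apply is_derive_on_spec; [exact Hx|]; intros eps Heps.
destruct (H x (fun P HP => HP) (mkposreal eps Heps)) as [d Hd].
exists d; split; [apply cond_pos|]; intros y _ Hyx; exact (Hd y Hyx).
Qed.

Lemma is_derive_on_plus_scal (a b e : R) (f g : R -> R) (x l m : R) :
  Icc a b x -> is_derive_on (Icc a b) f x l -> is_derive_on (Icc a b) g x m ->
  is_derive_on (Icc a b) (fun t => f t + e * g t) x (l + e * m).
Proof.
intros Hx; rewrite !is_derive_on_spec by assumption.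
intros Hf Hg eps Heps.
assert (He : 0 <= Rabs e) by apply Rabs_pos.
destruct (Hf (eps / 2)) as [d1 [Hd1 H1]]; [lra|].
(* The factor |e| + 1 instead of |e| keeps the tolerance meaningful when e = 0. *)
destruct (Hg (eps / (2 * (Rabs e + 1)))) as [d2 [Hd2 H2]].
{ apply Rdiv_lt_0_compat; lra. }
exists (Rmin d1 d2); split; [now apply Rmin_glb_lt|]; intros y Hy Hyx.
specialize (H1 y Hy (Rlt_le_trans _ _ _ Hyx (Rmin_l _ _))).
specialize (H2 y Hy (Rlt_le_trans _ _ _ Hyx (Rmin_r _ _))).
replace (f y + e * g y - (f x + e * g x) - (y - x) * (l + e * m))
  with ((f y - f x - (y - x) * l) + e * (g y - g x - (y - x) * m)) by ring.
eapply Rle_trans; [apply Rabs_triang|].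
rewrite Rabs_mult.
assert (H3 : Rabs e * Rabs (g y - g x - (y - x) * m)
             <= (Rabs e + 1) * (eps / (2 * (Rabs e + 1)) * Rabs (y - x))).
{ apply Rmult_le_compat; try apply Rabs_pos; lra. }
replace ((Rabs e + 1) * (eps / (2 * (Rabs e + 1)) * Rabs (y - x)))
  with (eps / 2 * Rabs (y - x)) in H3 by (field; lra).
lra.
Qed.

(** * Continuity, integrability and bounds on a compact interval *)

(** The derivative estimate with tolerance 1 gives |f y - f x| <= (|l| + 1) |y - x| near x. *)
Lemma ex_derive_on_continuous_on (a b : R) (f : R -> R) :
  (forall x, Icc a b x -> ex_derive_on (Icc a b) f x) ->
  continuous_on (Icc a b) f.
Proof.
intros H x Hx; destruct (H x Hx) as [l Hl].
rewrite is_derive_on_spec in Hl by assumption.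
destruct (Hl 1 Rlt_0_1) as [d [Hd Hd']].
apply filterlim_locally; intros eps.
assert (Hl0 : 0 <= Rabs l) by apply Rabs_pos.
assert (Heps := cond_pos eps).
assert (Hr : 0 < Rmin d (eps / (Rabs l + 1))).
{ apply Rmin_glb_lt; [exact Hd|]. apply Rdiv_lt_0_compat; lra. }
exists (mkposreal _ Hr); intros y Hyx Hy.
change (Rabs (y - x) < Rmin d (eps / (Rabs l + 1))) in Hyx.
change (Rabs (f y - f x) < eps).
specialize (Hd' y Hy (Rlt_le_trans _ _ _ Hyx (Rmin_l _ _))).
assert (Hyx' := Rlt_le_trans _ _ _ Hyx (Rmin_r _ _)).
apply (Rmult_lt_compat_l (Rabs l + 1)) in Hyx'; [|lra].
replace ((Rabs l + 1) * (eps / (Rabs l + 1))) with (pos eps) in Hyx'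
  by (field; lra).
replace (f y - f x) with ((f y - f x - (y - x) * l) + (y - x) * l) by ring.
eapply Rle_lt_trans; [apply Rabs_triang|]; rewrite Rabs_mult; nra.
Qed.

(* The retraction [t |-> max a (min b t)] of the line onto [a,b] turns
   continuity on [a,b] into continuity on the line. *)
Definition clamp (a b t : R) : R := Rmax a (Rmin b t).

Lemma clamp_id (a b t : R) : Icc a b t -> clamp a b t = t.
Proof.
intros [Ha Hb]; unfold clamp; rewrite Rmin_right, Rmax_right; lra.
Qed.

Lemma clamp_Icc (a b t : R) : a <= b -> Icc a b (clamp a b t).
Proof.
intros Hab; unfold Icc, clamp; split; [apply Rmax_l|].
apply Rmax_lub; [exact Hab|apply Rmin_l].
Qed.

Lemma clamp_lipschitz (a b s t : R) :
  Rabs (clamp a b s - clamp a b t) <= Rabs (s - t).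
Proof.
unfold clamp, Rmin; destruct (Rle_dec b s), (Rle_dec b t); unfold Rmax;
  repeat destruct (Rle_dec _ _); unfold Rabs; repeat destruct (Rcase_abs _); lra.
Qed.

(** [clamp] is 1-Lipschitz with values in [a,b], so a radius valid for f at [clamp a b x] is valid
    for the composite at x. *)
Lemma continuous_on_clamp (a b : R) (f : R -> R) (x : R) :
  a <= b -> continuous_on (Icc a b) f ->
  continuous (fun t => f (clamp a b t)) x.
Proof.
intros Hab Hf.
apply filterlim_locally; intros eps.
destruct (proj1 (filterlim_locally _ _) (Hf _ (clamp_Icc a b x Hab)) eps)
  as [d Hd].
exists d; intros y Hyx; apply Hd; [|now apply clamp_Icc].
exact (Rle_lt_trans _ _ _ (clamp_lipschitz a b y x) Hyx).
Qed.

Lemma continuous_on_of_continuous (D : R -> Prop) (f : R -> R) :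
  (forall x, D x -> continuous f x) -> continuous_on D f.
Proof.
intros H; now apply continuous_on_forall.
Qed.

Lemma continuous_on_congr (a b : R) (f g : R -> R) :
  (forall t, Icc a b t -> f t = g t) ->
  continuous_on (Icc a b) f -> continuous_on (Icc a b) g.
Proof.
intros Hfg; exact (continuous_on_ext _ f g Hfg).
Qed.

(** Composing with [clamp] leaves values on [a,b] unchanged, so closure properties of continuity on
    the line pass to [a,b]. *)
Lemma continuous_on_binop (a b : R) (op : R -> R -> R) (f g : R -> R) :
  a <= b ->
  (forall (u v : R -> R) x, continuous u x -> continuous v x ->
     continuous (fun t => op (u t) (v t)) x) ->
  continuous_on (Icc a b) f -> continuous_on (Icc a b) g ->
  continuous_on (Icc a b) (fun t => op (f t) (g t)).
Proof.
intros Hab Hop Hf Hg.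
apply continuous_on_congr
  with (f := fun t => op (f (clamp a b t)) (g (clamp a b t))).
- now intros t Ht; rewrite clamp_id.
- apply continuous_on_of_continuous; intros x _.
  now apply (Hop (fun t => f (clamp a b t)) (fun t => g (clamp a b t)));
    apply continuous_on_clamp.
Qed.

Lemma continuous_on_Rplus (a b : R) (f g : R -> R) :
  a <= b -> continuous_on (Icc a b) f -> continuous_on (Icc a b) g ->
  continuous_on (Icc a b) (fun t => f t + g t).
Proof.
intros Hab; apply (continuous_on_binop a b Rplus); [exact Hab|].
intros u v x; exact (continuous_plus u v x).
Qed.

Lemma continuous_on_Rmult (a b : R) (f g : R -> R) :
  a <= b -> continuous_on (Icc a b) f -> continuous_on (Icc a b) g ->
  continuous_on (Icc a b) (fun t => f t * g t).
Proof.
intros Hab; apply (continuous_on_binop a b Rmult); [exact Hab|].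
intros u v x; exact (continuous_mult u v x).
Qed.

Lemma continuous_on_const_R (D : R -> Prop) (c : R) :
  continuous_on D (fun _ => c).
Proof.
apply continuous_on_of_continuous; intros x _; apply continuous_const.
Qed.

Lemma ex_RInt_continuous_on (a b : R) (f : R -> R) :
  a <= b -> continuous_on (Icc a b) f -> ex_RInt f a b.
Proof.
intros Hab Hf.
apply ex_RInt_ext with (f := fun t => f (clamp a b t)).
- intros x; rewrite Rmin_left, Rmax_right by exact Hab; intros Hx.
  rewrite clamp_id; [reflexivity|unfold Icc; lra].
- apply (ex_RInt_continuous (V := R_CompleteNormedModule)); intros x _.
  now apply continuous_on_clamp.
Qed.

(** The bound is the maximum of |f|, obtained from the extreme value theorem for the clamped
    function. *)
Lemma continuous_on_bounded (a b : R) (f : R -> R) :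
  a <= b -> continuous_on (Icc a b) f ->
  exists M, 0 <= M /\ forall t, Icc a b t -> Rabs (f t) <= M.
Proof.
intros Hab Hf.
destruct (continuity_ab_maj (fun t => Rabs (f (clamp a b t))) a b Hab)
  as [x [Hx _]].
{ intros c _; apply continuity_pt_filterlim.
  apply (continuous_comp (fun t => f (clamp a b t)) Rabs).
  - now apply continuous_on_clamp.
  - apply continuous_Rabs. }
exists (Rabs (f (clamp a b x))); split; [apply Rabs_pos|].
intros t Ht; specialize (Hx t Ht); simpl in Hx.
now rewrite clamp_id in Hx.
Qed.

Lemma sup_norm_le (D : R -> Prop) (f : R -> R) (M : R) :
  0 <= M -> (forall t, D t -> Rabs (f t) <= M) -> sup_norm D f <= M.
Proof.
intros HM Hf; unfold sup_norm.
destruct (Lub_Rbar_correct (fun y => exists t, D t /\ y = Rabs (f t)))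
  as [_ Hlub].
assert (Hle : Rbar_le (Lub_Rbar (fun y => exists t, D t /\ y = Rabs (f t))) M).
{ apply Hlub; intros y [t [Ht ->]]; now apply Hf. }
(* [Hle] excludes plus infinity; for minus infinity (D empty) [real] returns 0, and [0 <= M]
   concludes. *)
destruct (Lub_Rbar _) as [r| |]; simpl in *; tauto || lra.
Qed.

(** A point where phi is nonzero belongs to the support, which lies in the open interval. *)
Lemma test_function_boundary (a b : R) (phi : R -> R) :
  test_function a b phi -> phi a = 0 /\ phi b = 0.
Proof.
intros [_ [_ Hsupp]].
split; [destruct (Req_dec (phi a) 0) as [E|N] | destruct (Req_dec (phi b) 0) as [E|N]];
  try exact E;
  assert (H := Hsupp _ (adherence_P1 (fun t => phi t <> 0) _ N)); lra.
Qed.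

(** * Perturbation of a curve by a multiple of a smooth function *)

Section Variation.

Variables (T : R) (phi : R -> R).
Hypothesis (hT : 0 < T) (hphi : forall n t, ex_derive_n phi n t).

Let I := Icc 0 T.

(** [ex_derive_n phi (S n)] unfolds to differentiability of the n-th derivative; indices 1, 2 and 3
    of [hphi] serve for phi and its first two derivatives. *)
Lemma is_derive_smooth (t : R) : is_derive phi t (Derive phi t).
Proof. exact (Derive_correct _ _ (hphi 1 t)). Qed.

Lemma is_derive_smooth2 (t : R) :
  is_derive (Derive phi) t (Derive (Derive phi) t).
Proof. exact (Derive_correct _ _ (hphi 2 t)). Qed.

Lemma continuous_on_phi : continuous_on I phi.
Proof.
apply continuous_on_of_continuous; intros x _;
  apply (ex_derive_continuous (K := R_AbsRing) (V := R_NormedModule)).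
exact (hphi 1 x).
Qed.

Lemma continuous_on_Dphi : continuous_on I (Derive phi).
Proof.
apply continuous_on_of_continuous; intros x _;
  apply (ex_derive_continuous (K := R_AbsRing) (V := R_NormedModule)).
exact (hphi 2 x).
Qed.

Lemma continuous_on_DDphi : continuous_on I (Derive (Derive phi)).
Proof.
apply continuous_on_of_continuous; intros x _;
  apply (ex_derive_continuous (K := R_AbsRing) (V := R_NormedModule)).
exact (hphi 3 x).
Qed.

Lemma Derive_on_perturb (zeta : R -> R) (e t : R) :
  (forall x, I x -> ex_derive_on I zeta x) -> I t ->
  is_derive_on I (fun s => zeta s + e * phi s) t
    (Derive_on I zeta t + e * Derive phi t).
Proof.
intros Hz Ht; apply is_derive_on_plus_scal; [exact Ht| |].
- apply Derive_on_correct; auto.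
- apply is_derive_on_of_is_derive; [exact Ht|]; apply is_derive_smooth.
Qed.

(** The formula for the first derivative is available on [0,T] only, so it is substituted through
    [is_derive_on_ext], which compares functions there. *)
Lemma Derive_on_perturb2 (zeta : R -> R) (e t : R) :
  Ck_on I 2 zeta -> I t ->
  is_derive_on I (Derive_on I (fun s => zeta s + e * phi s)) t
    (Derive_on I (Derive_on I zeta) t + e * Derive (Derive phi) t).
Proof.
intros [Hz [Hz' _]] Ht.
apply is_derive_on_ext
  with (f := fun s => Derive_on I zeta s + e * Derive phi s); [exact Ht| |].
- intros s Hs; symmetry; apply Derive_on_eq; [exact hT|exact Hs|].
  now apply Derive_on_perturb.
- apply is_derive_on_plus_scal; [exact Ht| |].
  + apply Derive_on_correct; auto.
  + apply is_derive_on_of_is_derive; [exact Ht|]; apply is_derive_smooth2.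
Qed.

Lemma Ck_on_perturb (zeta : R -> R) (e : R) :
  Ck_on I 2 zeta -> Ck_on I 2 (fun s => zeta s + e * phi s).
Proof.
intros Hz; assert (Hz0 := Hz); destruct Hz0 as [Hz1 [Hz2 Hz3]].
split; [|split].
- intros x Hx; eexists; now apply Derive_on_perturb.
- intros x Hx; eexists; now apply Derive_on_perturb2.
- apply continuous_on_congr with
    (f := fun t => Derive_on I (Derive_on I zeta) t + e * Derive (Derive phi) t).
  + intros t Ht; symmetry; apply Derive_on_eq; [exact hT|exact Ht|].
    now apply Derive_on_perturb2.
  + apply continuous_on_Rplus; [lra|exact Hz3|].
    apply continuous_on_Rmult; [lra|apply continuous_on_const_R|].
    apply continuous_on_DDphi.
Qed.

(** M is the sum of bounds for phi and its first two derivatives. It is fixed before e, so that e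
    can later be chosen in terms of M. *)
Lemma C2_norm_perturb :
  exists M, 0 <= M /\ forall (zeta : R -> R) (e : R),
    C2_norm I (fun t => zeta t + e * phi t - zeta t) <= Rabs e * M.
Proof.
destruct (continuous_on_bounded 0 T phi ltac:(lra) continuous_on_phi)
  as [M0 [HM0 H0]].
destruct (continuous_on_bounded 0 T _ ltac:(lra) continuous_on_Dphi)
  as [M1 [HM1 H1]].
destruct (continuous_on_bounded 0 T _ ltac:(lra) continuous_on_DDphi)
  as [M2 [HM2 H2]].
exists (M0 + M1 + M2); split; [lra|]; intros zeta e.
set (f := fun t => zeta t + e * phi t - zeta t).
assert (He := Rabs_pos e).
(* [f] equals e * phi on the whole line, hence ordinary derivatives of phi can be used. *)
assert (D1 : forall t, I t -> is_derive_on I f t (e * Derive phi t)).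
{ intros t Ht; apply is_derive_on_of_is_derive; [exact Ht|].
  apply is_derive_ext with (f := fun t => e * phi t).
  { intros s; unfold f; simpl; ring. }
  apply is_derive_scal, is_derive_smooth. }
assert (E1 : forall t, I t -> Derive_on I f t = e * Derive phi t).
{ intros t Ht; apply Derive_on_eq; auto. }
assert (E2 : forall t, I t ->
  Derive_on I (Derive_on I f) t = e * Derive (Derive phi) t).
{ intros t Ht; apply Derive_on_eq; [exact hT|exact Ht|].
  apply is_derive_on_ext with (f := fun t => e * Derive phi t); [exact Ht| |].
  { intros s Hs; symmetry; auto. }
  apply is_derive_on_of_is_derive; [exact Ht|]; apply is_derive_scal, is_derive_smooth2. }
unfold C2_norm; rewrite !Rmult_plus_distr_l.
repeat apply Rplus_le_compat; apply sup_norm_le; try nra; intros t Ht.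
- unfold f; replace (zeta t + e * phi t - zeta t) with (e * phi t) by ring.
  rewrite Rabs_mult; apply Rmult_le_compat_l; auto.
- rewrite E1, Rabs_mult by exact Ht; apply Rmult_le_compat_l; auto.
- rewrite E2, Rabs_mult by exact Ht; apply Rmult_le_compat_l; auto.
Qed.

(** As a function of c, J (zeta + c phi) is a polynomial of degree at most 2; the second difference
    isolates its leading coefficient. *)
Lemma J_second_difference (theta eta zeta : R -> R) (e : R) :
  continuous_on I theta -> continuous_on I eta -> Ck_on I 2 zeta ->
  J T theta eta (fun t => zeta t + e * phi t)
  + J T theta eta (fun t => zeta t + - e * phi t)
  - 2 * J T theta eta zeta
  = 2 * e ^ 2 * (RInt (fun t => phi t * Derive phi t * theta t) 0 T
                 - RInt (fun t => (Derive phi t) ^ 2 * eta t) 0 T).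
Proof.
intros Hth Het [Hz [Hz' _]].
assert (hT' : 0 <= T) by lra.
assert (Cz := ex_derive_on_continuous_on 0 T zeta Hz).
assert (Cz' := ex_derive_on_continuous_on 0 T _ Hz').
assert (Cp := continuous_on_phi); assert (Cp' := continuous_on_Dphi).
fold I in Cz, Cz'.
set (z' := Derive_on I zeta) in *; set (p' := Derive phi) in *.
(* Coefficients of 1, e and e^2 in the integrand of J (zeta + e phi). *)
set (A := fun t => theta t * (z' t * zeta t) + - 1 * (eta t * (z' t * z' t))).
set (B := fun t => theta t * (z' t * phi t) + theta t * (p' t * zeta t)
                   + - 2 * (eta t * (z' t * p' t))).
set (P := fun t => phi t * p' t * theta t).
set (N := fun t => p' t ^ 2 * eta t).
(* Subtractions in [A] and [B] are written as sums with factors -1 and -2, so that the closure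
   lemmas for sums and products match. *)
assert (IA : ex_RInt A 0 T).
{ apply ex_RInt_continuous_on; [exact hT'|].
  repeat (apply continuous_on_Rplus || apply continuous_on_Rmult
          || apply continuous_on_const_R || assumption). }
assert (IB : ex_RInt B 0 T).
{ apply ex_RInt_continuous_on; [exact hT'|].
  repeat (apply continuous_on_Rplus || apply continuous_on_Rmult
          || apply continuous_on_const_R || assumption). }
assert (IP : ex_RInt P 0 T).
{ apply ex_RInt_continuous_on; [exact hT'|].
  repeat (apply continuous_on_Rmult || assumption). }
assert (IN : ex_RInt N 0 T).
(* [simpl] expands the square into a product ending in the constant 1. *)
{ apply ex_RInt_continuous_on; [exact hT'|]; unfold N; simpl.
  repeat (apply continuous_on_Rmult || apply continuous_on_const_R
          || assumption). }
assert (HJ : forall c, J T theta eta (fun t => zeta t + c * phi t)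
  = RInt A 0 T + c * RInt B 0 T + c ^ 2 * (RInt P 0 T - RInt N 0 T)).
{ intros c; unfold J; apply is_RInt_unique.
  apply is_RInt_ext with
    (f := fun t => plus (plus (A t) (scal c (B t)))
                        (scal (c ^ 2) (minus (P t) (N t)))).
  - intros t; rewrite Rmin_left, Rmax_right by exact hT'; intros Ht.
    assert (It : I t) by (unfold I, Icc; lra).
    rewrite (Derive_on_eq _ _ _ _ _ hT It (Derive_on_perturb zeta c t Hz It)).
    fold z' p'; unfold A, B, P, N, plus, scal, minus, opp; simpl.
    unfold mult, plus; simpl; ring.
  - apply (is_RInt_plus (V := R_NormedModule));
      [apply (is_RInt_plus (V := R_NormedModule))|].
    + now apply (RInt_correct (V := R_CompleteNormedModule)).
    + apply (is_RInt_scal (V := R_NormedModule)).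
      now apply (RInt_correct (V := R_CompleteNormedModule)).
    + apply (is_RInt_scal (V := R_NormedModule)).
      apply (is_RInt_minus (V := R_NormedModule));
        now apply (RInt_correct (V := R_CompleteNormedModule)). }
(* Taking c = 0 in [HJ] would concern [fun t => zeta t + 0 * phi t], a different term from [zeta];
   the value is computed directly. *)
assert (HJ0 : J T theta eta zeta = RInt A 0 T).
{ unfold J; apply RInt_ext; intros t _; fold I z'; unfold A; simpl; ring. }
rewrite !HJ, HJ0; ring.
Qed.

End Variation.

(** * Choice of the step size and sign of the second difference *)

Theorem proposition10 (T Q : R) (theta eta : R -> R)
  (hT : 0 < T) (hQ : 0 < Q)
  (htheta : Ck_on (Icc 0 T) 1 theta)
  (heta : Ck_on (Icc 0 T) 1 eta)
  (htheta_pos : forall t, Icc 0 T t -> 0 < theta t)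
  (heta_pos : forall t, Icc 0 T t -> 0 < eta t)
  (zeta : R -> R)
  (hextr : extremal_point T Q theta eta zeta)
  (hmax : local_maximum T Q theta eta zeta) :
  forall phi : R -> R, test_function 0 T phi ->
    RInt (fun t => phi t * Derive phi t * theta t) 0 T
    <= RInt (fun t => (Derive phi t) ^ 2 * eta t) 0 T.
Proof.
intros phi hphi.
destruct (test_function_boundary _ _ _ hphi) as [phi0 phiT].
destruct hphi as [smooth _].
destruct hmax as [[Cz [z0 zT]] [delta [Hdelta Hmax]]].
destruct (C2_norm_perturb T phi hT smooth) as [M [HM Hnorm]].
(* Dividing by M + 1 ensures e M < delta and allows M = 0. *)
set (e := delta / (M + 1)).
assert (He : 0 < e) by (apply Rdiv_lt_0_compat; lra).
assert (HeM : e * M < delta).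
{ replace delta with (e * (M + 1)) by (unfold e; field; lra); nra. }
(* Both signs of c are admissible: phi vanishes at 0 and T, so the boundary values are kept, and the
   distance to zeta is at most e M. *)
assert (Hstep : forall c, Rabs c = e ->
  J T theta eta (fun t => zeta t + c * phi t) <= J T theta eta zeta).
{ intros c Hc; apply Hmax.
  - split; [|rewrite phi0, phiT, z0, zT; lra].
    exact (Ck_on_perturb T phi hT smooth zeta c Cz).
  - eapply Rle_lt_trans; [apply Hnorm|]; now rewrite Hc. }
assert (Hp := Hstep e (Rabs_pos_eq e (Rlt_le _ _ He))).
assert (Hm := Hstep (- e)
  (eq_trans (Rabs_Ropp e) (Rabs_pos_eq e (Rlt_le _ _ He)))).
assert (H := J_second_difference T phi hT smooth theta eta zeta e
  (ex_derive_on_continuous_on 0 T theta (proj1 htheta))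
  (ex_derive_on_continuous_on 0 T eta (proj1 heta)) Cz).
assert (He2 : 0 < e ^ 2) by now apply pow_lt.
(* By [Hp] and [Hm] the left side of [H] is at most 0; dividing by 2 e^2 > 0 gives the
   inequality. *)
nra.
Qed.
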